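(* Consider the unperturbed spreading algorithm described in the context, on a connected graph $\mathcal{G}=(V,E)$. Let $x=(x_i)_{i\in V}$ be the stationary point, $\mathcal{D}(\mathcal{G})$ the effective diameter, $$T=\Big\lceil \frac{x_{\max}-\hat{x}_{\min}(t_0)}{\min\{\sigma,\delta\}}\Big\rceil,$$ and $$T_i=\max\Big\{0,\Big\lceil \frac{M-x_{i\min}}{\delta}\Big\rceil\Big\}+2,\qquad x_{i\min}=\min_{j\in\mathcal{F}_i}x_j,\qquad i\in\{0,\dots,\mathcal{D}(\mathcal{G})-1\}.$$ Then for every $i\in V$, $$\hat{x}_i(t)=x_i\quad\text{for all } t> t_0+T+\sum_{l=0}^{\mathcal{D}(\mathcal{G})-1}T_l .$$
   Context: Setting. $\mathcal{G}=(V,E)$ is a finite connected undirected graph, $V=\{1,\dots,N\}$; $\mathcal{N}(i)$ is the set of neighbors of $i$. Each pair of neighbors has an edge value $e_{ik}=e_{ki}$ with $0<e_{\min}\le e_{ik}<\infty$. Each node has a maximum value $s_i\ge 0$, finite or infinite, and $\mathcal{S}^*=\{i\in V: s_i<\infty\}$ is nonempty. The function $f(a,b)$ (first argument a state value, second an edge value) is finite for finite $a,b$; it is progressive: for some $\sigma>0$, $f(a,b)>a+\sigma$; and it is monotonic in its first argument: $f(a_1,b)\ge f(a_2,b)$ if $a_1\ge a_2$. Algorithm. Time $t$ is an integer, $t\ge t_0$; the initial estimates $\hat{x}_i(t_0)$ are non-negative real numbers. Constants: finite $M\ge0$, $\delta>0$, $D\ge 0$, and a function $g$, finite for finite arguments,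 with $g(y)\ge y+\delta$. For $t\ge t_0$, $\tilde{x}_i(t+1)=\min\{\min_{k\in\mathcal{N}(i)}f(\hat{x}_k(t),e_{ik}),\,s_i\}$, and $\hat{x}_i(t+1)=\tilde{x}_i(t+1)$ if $\hat{x}_i(t)\ge M$ or $|\hat{x}_i(t)-\tilde{x}_i(t+1)|\le D$; otherwise $\hat{x}_i(t+1)=g(\hat{x}_i(t))$. Stationary point. $x=(x_i)_{i\in V}$ is the unique solution of $x_i=\min\{\min_{k\in\mathcal{N}(i)}f(x_k,e_{ik}),s_i\}$ for all $i\in V$ (it exists, is unique, and all its entries are finite). $\mathcal{S}_\infty=\{i: x_i=s_i\}$ is the set of sources. $x_{\max}=\max_{k\in V}x_k$. True constraining nodes. If $x_i=s_i$, then $i$ is its own true constraining node. Any neighbor $k\in\mathcal{N}(i)$ that minimizes $f(x_k,e_{ik})$ over $\mathcal{N}(i)$ and satisfies $f(x_k,e_{ik})=x_i$ is also a true constraining node of $i$ (when $x_i<s_i$ these are all the minimizing $k$). Thus a source can have, besides itself, a neighbor as true constraining node. A shortest path from $i$ is a path starting at $i$ and ending at a node of $\mathcal{S}_\infty$, in which each node after the first is a true constraining node of its predecessor (the one-node path is allowed for $i\in\mathcal{S}_\infty$). $\mathcal{F}_l$ is the set of nodes whose longest (in number of nodes) shortest path has $l+1$ nodes. The effective diameter $\mathcal{D}(\mathcal{G})$ is the number of nodes in the longest shortest path among all $i\in V$. In general $\mathcal{F}_0\subset\mathcal{S}_\infty$ but not conversely: with $f(a,b)=a+b$, all edge values 1,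 nodes 2 and 3 adjacent to node 1, $s_1=0$, $s_2=1$, $s_3=\infty$, one has $x_1=0$, $x_2=x_3=1$, and node 2 is in $\mathcal{S}_\infty$ but lies in $\mathcal{F}_1$. The sets $\mathcal{F}_0,\dots,\mathcal{F}_{\mathcal{D}(\mathcal{G})-1}$ are nonempty and partition $V$. Definition of $\hat{x}_{\min}(t_0)$. Let $\mathcal{U}(t_0)=V\setminus\{i\in\mathcal{S}^*:\hat{x}_i(t_0)=s_i\}$. If $\mathcal{U}(t_0)\neq\emptyset$, $\hat{x}_{\min}(t_0)=\min_{j\in\mathcal{U}(t_0)}\hat{x}_j(t_0)$.
   Formalization: T is taken as the maximum of 0 and the displayed ceiling, since the stated bound is false when that ceiling is very negative (all initial estimates far above x_max), and T is 0 when U(t_0) is empty, where x̂_min(t_0) is undefined. *)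

(* Defs.v *)
From mathcomp Require Import all_boot all_order all_algebra.
From mathcomp Require Import reals constructive_ereal.

Set Implicit Arguments.
Unset Strict Implicit.
Unset Printing Implicit Defensive.

Import Order.TTheory GRing.Theory Num.Theory.
Local Open Scope ring_scope.

(* Minimum and maximum of y over A; meaningful for nonempty A only
   (both are 0 when A is empty). *)
Definition set_min (R : realType) (V : finType) (A : {set V}) (y : V -> R) : R :=
  fine (\big[Order.min/+oo%E]_(j in A) (y j)%:E).

Definition set_max (R : realType) (V : finType) (A : {set V}) (y : V -> R) : R :=
  fine (\big[Order.max/-oo%E]_(j in A) (y j)%:E).

(* min { min_{k in N(i)} f(y_k, e_ik), s_i }, in the extended reals since s_i
   may be +oo; the minimum over an empty neighborhood is +oo. *)
Definition spread (R : realType) (V : finType) (adj : rel V) (e : V -> V -> R)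
    (s : V -> \bar R) (f : R -> R -> R) (y : V -> R) (i : V) : \bar R :=
  Order.min (\big[Order.min/+oo%E]_(k | adj i k) (f (y k) (e i k))%:E) (s i).

Definition stationary (R : realType) (V : finType) (adj : rel V)
    (e : V -> V -> R) (s : V -> \bar R) (f : R -> R -> R) (x : V -> R) : Prop :=
  forall i, (x i)%:E = spread adj e s f x i.

(* The equation in the first branch lives in \bar R: it determines
   xh (t + 1) i, because on a connected graph with some finite s_i the value
   of spread at real estimates is always finite.  Times before t0 are
   unconstrained. *)
Definition trajectory (R : realType) (V : finType) (adj : rel V)
    (e : V -> V -> R) (s : V -> \bar R) (f : R -> R -> R) (g : R -> R)
    (M D : R) (t0 : int) (xh : int -> V -> R) : Prop :=
  forall (t : int) (i : V), t0 <= t ->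
    let xt := spread adj e s f (xh t) i in
    if (M <= xh t i) || (`|(xh t i)%:E - xt| <= D%:E)%E
    then (xh (t + 1) i)%:E = xt
    else xh (t + 1) i = g (xh t i).

Definition finite_max (R : realType) (V : finType) (s : V -> \bar R) : {set V} :=
  [set i | (s i < +oo)%E].

Definition sources (R : realType) (V : finType) (s : V -> \bar R) (x : V -> R) :
    {set V} :=
  [set i | (x i)%:E == s i].

(* Argument order: k is a true constraining node of i. *)
Definition constraining (R : realType) (V : finType) (adj : rel V)
    (e : V -> V -> R) (s : V -> \bar R) (f : R -> R -> R) (x : V -> R) : rel V :=
  fun i k =>
    ((k == i) && (i \in sources s x))
    || [&& adj i k,
           [forall j, adj i j ==> (f (x k) (e i k) <= f (x j) (e i j))]
         & f (x k) (e i k) == x i].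

(* The node sequence i :: p.  It is a path of the graph, so that a source,
   although it constrains itself, is not repeated. *)
Definition shortest_path (R : realType) (V : finType) (adj : rel V)
    (e : V -> V -> R) (s : V -> \bar R) (f : R -> R -> R) (x : V -> R)
    (i : V) (p : seq V) : bool :=
  [&& path adj i p, uniq (i :: p), path (constraining adj e s f x) i p
    & last i p \in sources s x].

(* Some shortest path from i has n.+1 nodes. *)
Definition has_shortest_path (R : realType) (V : finType) (adj : rel V)
    (e : V -> V -> R) (s : V -> \bar R) (f : R -> R -> R) (x : V -> R)
    (i : V) (n : nat) : bool :=
  [exists p : n.-tuple V, shortest_path adj e s f x i p].

(* F_l: the longest shortest path from i has l.+1 nodes.  Nodes of a path are
   distinct, so only n < #|V| matters. *)
Definition layer (R : realType) (V : finType) (adj : rel V)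
    (e : V -> V -> R) (s : V -> \bar R) (f : R -> R -> R) (x : V -> R)
    (l : nat) : {set V} :=
  [set i | has_shortest_path adj e s f x i l &&
           [forall n : 'I_#|V|,
              has_shortest_path adj e s f x i n ==> (n <= l)%N]].

(* Counted in nodes, hence the successor. *)
Definition effective_diameter (R : realType) (V : finType) (adj : rel V)
    (e : V -> V -> R) (s : V -> \bar R) (f : R -> R -> R) (x : V -> R) : nat :=
  (\max_(i : V) \max_(n < #|V| | has_shortest_path adj e s f x i n) n.+1)%N.

(* U(t0), where y stands for the initial estimates. *)
Definition unsettled (R : realType) (V : finType) (s : V -> \bar R)
    (y : V -> R) : {set V} :=
  ~: [set i in finite_max s | (y i)%:E == s i].

(* The number T of steps after which no estimate is below its stationary
   value; y stands for the initial estimates.  When every estimate in U(t0)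
   exceeds x_max by enough, the rounded quotient is negative; no estimate is
   then below its stationary value, and T is 0.  (With a negative T the
   convergence bound could precede t0 and would be false.)  T is also 0 when
   U(t0) is empty, where the minimum is over nothing. *)
Definition raising_time (R : realType) (V : finType) (s : V -> \bar R)
    (sigma delta : R) (x y : V -> R) : int :=
  let U := unsettled s y in
  if U == set0 then 0
  else Num.max 0
         (Num.ceil ((set_max setT x - set_min U y) / Num.min sigma delta)).

Definition layer_time (R : realType) (V : finType) (adj : rel V)
    (e : V -> V -> R) (s : V -> \bar R) (f : R -> R -> R) (M delta : R)
    (x : V -> R) (l : nat) : int :=
  Num.max 0
    (Num.ceil ((M - set_min (layer adj e s f x l) x) / delta)) + 2.

(* Main.v *)
Require Import Defs.
From mathcomp Require Import all_boot all_order all_algebra.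
From mathcomp Require Import reals constructive_ereal.

Set Implicit Arguments.
Unset Strict Implicit.
Unset Printing Implicit Defensive.

Import Order.TTheory GRing.Theory Num.Theory.
Local Open Scope ring_scope.

(* Two phases.  Writing m = min(sigma, delta), an estimate below its stationary
   value gains at least m per step, because both f and g increase their argument
   by at least m; once at or above the stationary value it stays there, by
   monotonicity of f and stationarity.  Hence after T steps no estimate is too
   low.  From then on, a node having a settled true constraining node (or being
   a source) receives exactly its stationary value as the candidate: either it
   adopts it, or it rises by at least delta, which can happen only while it is
   below M.  Stationary values strictly decrease along a shortest path, so the
   true constraining neighbors of a node in F_l lie in earlier layers, and the
   layers settle one after the other. *)

(** * Minima and maxima over a set *)

Section SetExtrema.
Variables (R : realType) (V : finType).
Implicit Types (A : {set V}) (y : V -> R).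

Lemma set_min_le A y j : j \in A -> set_min A y <= y j.
Proof.
move=> jA; rewrite /set_min.
set m := \big[_/_]_(_ in _) _.
have mj : (m <= (y j)%:E)%E by exact: (@bigmin_le_cond _ _ _ +oo%E j (mem A)).
(* [fine] sends both infinities to 0, so [m] must be finite: [mj] excludes +oo and this bound
   excludes -oo. *)
have mN : (-oo < m)%E by apply/bigmin_gtP; split=> // k _; exact: ltNyr.
by case: m mj mN.
Qed.

Lemma le_set_max A y j : j \in A -> y j <= set_max A y.
Proof.
move=> jA; rewrite /set_max.
set m := \big[_/_]_(_ in _) _.
have mj : ((y j)%:E <= m)%E by exact: (@le_bigmax_cond _ _ _ -oo%E j (mem A)).
have mN : (m < +oo)%E by apply: bigmax_lt => // k _; exact: ltry.
by case: m mj mN.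
Qed.

End SetExtrema.

Section Spreading.
Variables (R : realType) (V : finType) (adj : rel V).
Hypothesis adj_irr : irreflexive adj.
Variables (e : V -> V -> R) (emin : R).
Hypothesis e_ge : forall i k, adj i k -> emin <= e i k.
Variable s : V -> \bar R.
Variables (f : R -> R -> R) (sigma : R).
Hypothesis sigma_gt0 : 0 < sigma.
Hypothesis f_prog : forall a b, emin <= b -> a + sigma < f a b.
Hypothesis f_mono : forall a1 a2 b, emin <= b -> a2 <= a1 -> f a2 b <= f a1 b.
Variable x : V -> R.
Hypothesis x_stat : stationary adj e s f x.

Local Notation spr := (spread adj e s f).
Local Notation src := (sources s x).
Local Notation cons := (constraining adj e s f x).
Local Notation spath := (shortest_path adj e s f x).
Local Notation has_spath := (has_shortest_path adj e s f x).
Local Notation F := (layer adj e s f x).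
Local Notation diameter := (effective_diameter adj e s f x).

(** * Stationary point and true constraining nodes *)

Lemma spread_geP (z : R) (y : V -> R) (i : V) :
  reflect ((z%:E <= s i)%E /\ forall k, adj i k -> z <= f (y k) (e i k))
    (z%:E <= spr y i)%E.
Proof.
rewrite /spr /spread le_min; apply: (iffP andP).
  by case=> /bigmin_geP[_ fz] sz; split.
case=> sz fz; split=> //; apply/bigmin_geP; split; first exact: leey.
by move=> k ik; rewrite lee_fin fz.
Qed.

Lemma stationary_le_max i : ((x i)%:E <= s i)%E.
Proof. by have /spread_geP[] : ((x i)%:E <= spr x i)%E by rewrite -x_stat. Qed.

Lemma stationary_le_f i k : adj i k -> x i <= f (x k) (e i k).
Proof.
have /spread_geP[_ fx] : ((x i)%:E <= spr x i)%E by rewrite -x_stat.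
exact: fx.
Qed.

(** Stationarity bounds every [f (x j) (e i j)] below by [x i], so a neighbor attaining [x i] is a
    minimizer; irreflexivity of [adj] excludes the self-constraining case. *)
Lemma constrainingP i k : adj i k -> reflect (f (x k) (e i k) = x i) (cons i k).
Proof.
move=> ik; rewrite /cons /constraining ik /=.
case: eqVneq => [ki|_] /=; first by rewrite ki adj_irr in ik.
apply: (iffP andP) => [[_ /eqP //]|fx]; split; last exact/eqP.
by apply/forallP => j; apply/implyP => ij; rewrite fx stationary_le_f.
Qed.

Lemma constraining_lt i k : adj i k -> cons i k -> x k < x i.
Proof.
move=> ik /(constrainingP ik) <-.
by apply: lt_trans (f_prog _ (e_ge ik)); rewrite ltrDl.
Qed.

(** Otherwise all terms of the minimum, [s i] included, would lie strictly above [x i], and so would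
    the minimum itself, against stationarity. *)
Lemma exists_constraining i :
  i \notin src -> exists2 k, adj i k & cons i k.
Proof.
move=> isrc; apply/exists_inP; apply: contraT => /exists_inPn noc.
have : ((x i)%:E < spr x i)%E.
  rewrite /spr /spread lt_min; apply/andP; split; last first.
    by move: isrc; rewrite inE lt_neqAle => ->; exact: stationary_le_max.
  apply/bigmin_gtP; split; first exact: ltry.
  move=> k ik; rewrite lte_fin lt_neqAle stationary_le_f // andbT.
  by apply: contra (noc k ik) => /eqP fx; apply/(constrainingP ik).
by rewrite -x_stat ltxx.
Qed.

(** * Shortest paths and layers *)

Lemma shortest_path_decreasing i p :
  path adj i p -> path cons i p -> path (fun j k => x k < x j) i p.
Proof.
elim: p i => //= k p IHp i /andP[ik adjp] /andP[cik consp].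
by rewrite constraining_lt // IHp.
Qed.

Lemma shortest_path_cons i k p :
  adj i k -> cons i k -> spath k p -> spath i (k :: p).
Proof.
move=> ik cik /and4P[adjp _ consp lastp].
have adjkp : path adj i (k :: p) by rewrite /= ik.
have conskp : path cons i (k :: p) by rewrite /= cik.
apply/and4P; split=> //.
(* Values of [x] strictly decrease along the path, so no node repeats. *)
apply: (@sorted_uniq _ (fun j j' => x j' < x j)); last 1 first.
- exact: shortest_path_decreasing.
- by move=> a b c ba cb; exact: lt_trans cb ba.
- by move=> a; exact: ltxx.
Qed.

Lemma has_shortest_pathP i n :
  reflect (exists2 p, size p = n & spath i p) (has_spath i n).
Proof.
apply: (iffP existsP) => [[p ip]|[p pn ip]].
  by exists p; rewrite ?size_tuple.
by exists (Tuple (introT eqP pn)).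
Qed.

(** Justifies looking only at lengths below [#|V|] in [layer] and [effective_diameter]. *)
Lemma has_shortest_path_bound i n : has_spath i n -> (n < #|V|)%N.
Proof.
move=> /has_shortest_pathP[p <- /and4P[_ up _ _]].
by rewrite -[(size p).+1]/(size (i :: p)) -(card_uniqP up) max_card.
Qed.

Lemma exists_shortest_path i : exists p, spath i p.
Proof.
(* Induction on the number of nodes with stationary value below [x i], which drops on passing to a
   constraining neighbor. *)
have [m] := ubnP #|[set j | x j < x i]|.
elim: m i => // m IHm i ltm.
have [isrc|/exists_constraining[k ik cik]] := boolP (i \in src).
  by exists [::]; apply/and4P.
have lt_ki := constraining_lt ik cik.
have [|p kp] := IHm k; last by exists (k :: p); exact: shortest_path_cons.
rewrite -ltnS; apply: leq_trans ltm; rewrite ltnS; apply: proper_card.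
apply/properP; split.
  by apply/subsetP=> j; rewrite !inE => /lt_trans; apply.
by exists k; rewrite !inE ?ltxx.
Qed.

Lemma exists_layer i : exists2 l, i \in F l & (l < diameter)%N.
Proof.
have exl : exists l, has_spath i l.
  have [p ip] := exists_shortest_path i.
  by exists (size p); apply/has_shortest_pathP; exists p.
have ubl l : has_spath i l -> (l <= #|V|)%N.
  by move/has_shortest_path_bound/ltnW.
have [l il maxl] := ex_maxnP exl ubl.
exists l.
  rewrite inE; apply/andP; split=> //.
  by apply/forallP => n; apply/implyP => /maxl.
apply: leq_trans (leq_bigmax_cond i _) => //.
by apply: leq_trans (leq_bigmax_cond (Ordinal (has_shortest_path_bound il)) _).
Qed.

(** Prepending [i] to a shortest path from [k] with [l'] edges gives one from [i] with [l' + 1]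
    edges. *)
Lemma constraining_layer i k l l' :
  adj i k -> cons i k -> i \in F l -> k \in F l' -> (l' < l)%N.
Proof.
move=> ik cik; rewrite !inE => /andP[_ /forallP maxl] /andP[kl' _].
have il' : has_spath i l'.+1.
  have /has_shortest_pathP[p pl' kp] := kl'.
  apply/has_shortest_pathP; exists (k :: p); first by rewrite /= pl'.
  exact: shortest_path_cons.
have := maxl (Ordinal (has_shortest_path_bound il')).
by move/implyP; apply.
Qed.

(** * Raising the estimates *)

Variables (M delta D : R).
Hypothesis delta_gt0 : 0 < delta.
Hypothesis D_ge0 : 0 <= D.
Variable g : R -> R.
Hypothesis g_ge : forall y, y + delta <= g y.
Variables (t0 : int) (xh : int -> V -> R).
Hypothesis xh_traj : trajectory adj e s f g M D t0 xh.

(** Times from [t0] on are indexed by naturals, for induction. *)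
Definition est (n : nat) : V -> R := xh (t0 + n%:Z).

Lemma trajectory_step n i :
  (est n.+1 i)%:E = spr (est n) i \/
  est n.+1 i = g (est n i) /\ est n i < M /\
    ~~ (`|(est n i)%:E - spr (est n) i| <= D%:E)%E.
Proof.
have -> : est n.+1 = xh (t0 + n%:Z + 1) by rewrite /est -addn1 PoszD addrA.
have := @xh_traj (t0 + n%:Z) i; rewrite lerDl => /(_ isT) /=.
case: ifPn => [_|]; first by left.
by rewrite negb_or -ltNge => /andP[ltM gtD] ?; right.
Qed.

(** The cap [x i] keeps the bound inductive: a neighbor [k] that has reached [x k] guarantees only
    [x i], by stationarity and monotonicity, while one known only to have reached the common level
    lifts it by [m]. *)
Lemma raising_invariant c n :
  (forall i, Num.min (x i) c <= est 0 i) ->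
  forall i, Num.min (x i) (c + Num.min sigma delta *+ n) <= est n i.
Proof.
move=> init; set m := Num.min sigma delta.
have [msigma mdelta] : m <= sigma /\ m <= delta by rewrite !ge_min !lexx orbT.
elim: n => [|n IHn] i; first by rewrite addr0.
have [eq_spr|[-> _]] := trajectory_step n i; last first.
  apply: le_trans (g_ge _); rewrite mulrSr addrA ge_min.
  move: (IHn i); rewrite ge_min => /orP[le_x|le_c]; apply/orP; [left|right].
    by apply: le_trans le_x _; rewrite lerDl ltW.
  exact: lerD.
rewrite -lee_fin eq_spr; apply/spread_geP; split.
  by apply: le_trans (stationary_le_max i); rewrite lee_fin ge_min lexx.
move=> k ik; rewrite ge_min.
move: (IHn k); rewrite ge_min => /orP[le_x|le_c]; apply/orP; [left|right].
  exact: le_trans (stationary_le_f ik) (f_mono (e_ge ik) le_x).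
apply: le_trans (ltW (f_prog _ (e_ge ik))).
by rewrite mulrSr addrA lerD.
Qed.

Lemma raising_time_ge0 : 0 <= raising_time s sigma delta x (est 0).
Proof. by rewrite /raising_time; case: ifP => // _; rewrite le_max lexx. Qed.

Lemma estimates_raised n i :
  raising_time s sigma delta x (est 0) <= n%:Z -> x i <= est n i.
Proof.
have settled j : j \notin unsettled s (est 0) -> x j <= est 0 j.
  rewrite !inE negbK => /andP[_ /eqP eq_s].
  by rewrite -lee_fin eq_s stationary_le_max.
rewrite /raising_time; set U := unsettled _ _; set c := set_min U _.
set m := Num.min sigma delta.
have m_gt0 : 0 < m by rewrite lt_min sigma_gt0.
have [U0 _|U0] := eqVneq U set0.
  (* All estimates start at or above their stationary values, so any level is admissible; [x i]
     collapses the minimum. *)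
  have init j : Num.min (x j) (x i) <= est 0 j.
    by rewrite ge_min settled // -/U U0 inE.
  have := raising_invariant n init i.
  by rewrite min_l // lerDl mulrn_wge0 ?ltW.
rewrite ge_max => /andP[_ le_n].
have init j : Num.min (x j) c <= est 0 j.
  rewrite ge_min; have [jU|/settled -> //] := boolP (j \in U).
  by rewrite set_min_le ?orbT.
apply: le_trans (raising_invariant n init i).
(* The level [c + m *+ n] has reached x_max, since [n] is at least the rounded quotient. *)
rewrite le_min lexx /= -lerBlDl.
apply: (@le_trans _ _ (set_max setT x - c)).
  by rewrite lerB // le_set_max ?inE.
rewrite -mulr_natl -ler_pdivrMr //.
apply: le_trans (ceil_ge _) _.
by rewrite -[n%:R]/(n%:~R) ler_int.
Qed.

(** * Settling, layer by layer *)

Lemma spread_settled n i :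
    (forall j, x j <= est n j) ->
    i \in src \/ (exists2 k, adj i k & cons i k /\ est n k = x k) ->
  spr (est n) i = (x i)%:E.
Proof.
move=> ge_x ci; apply/eqP; rewrite eq_le; apply/andP; split; last first.
  apply/spread_geP; split=> [|k ik]; first exact: stationary_le_max.
  exact: le_trans (stationary_le_f ik) (f_mono (e_ge ik) (ge_x k)).
(* For the upper bound, one term of the minimum equals [x i]: that of [s i] for a source, that of
   the settled node [k] in the other case. *)
rewrite /spr /spread ge_min; case: ci => [|[k ik [cik eqk]]].
  by rewrite inE => /eqP ->; rewrite lexx orbT.
apply/orP; left; apply: (bigmin_inf k) => //.
by rewrite eqk lee_fin; move/(constrainingP ik): cik => ->.
Qed.

(** Each rejection of the candidate [x i] raises the estimate by at least [delta]; after [q]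
    rejections it is at least [M], and the next step must adopt the candidate. *)
Lemma settling n0 i :
    (forall n j, (n0 <= n)%N -> x j <= est n j) ->
    (forall n, (n0 <= n)%N -> spr (est n) i = (x i)%:E) ->
  forall n q, M <= x i + delta *+ q -> (n0 + q < n)%N -> est n i = x i.
Proof.
move=> ge_x spr_x n q leM.
have stay k : (n0 <= k)%N -> est k i = x i -> est k.+1 i = x i.
  move=> le_k eq_x; have [|[_ [_]]] := trajectory_step k i.
    by rewrite spr_x // => -[].
  (* An estimate equal to its candidate is at distance 0, within [D], so the branch of [g] is
     closed. *)
  by rewrite spr_x // eq_x subee // abse0 lee_fin D_ge0.
have rise k : est (n0 + k) i = x i \/ x i + delta *+ k <= est (n0 + k) i.
  elim: k => [|k [eq_x|le_x]]; first by right; rewrite addr0 ge_x ?addn0.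
    by left; rewrite addnS stay ?leq_addr.
  rewrite addnS; have [|[-> _]] := trajectory_step (n0 + k) i.
    by rewrite spr_x ?leq_addr // => -[]; left.
  by right; rewrite mulrSr addrA; apply: le_trans (g_ge _); rewrite lerD2r.
have settled : est (n0 + q).+1 i = x i.
  have [/stay->//|le_x] := rise q; first exact: leq_addr.
  have [|[_ [ltM _]]] := trajectory_step (n0 + q) i.
    by rewrite spr_x ?leq_addr // => -[].
  by have := lt_le_trans ltM (le_trans leM le_x); rewrite ltxx.
move=> /subnK <-; elim: (n - _)%N => [//|k IHk].
by rewrite addSn stay // addnS addnCA leqW // leq_addr.
Qed.

Local Notation ltime := (layer_time adj e s f M delta x).

Lemma layer_time_ge0 l : 0 <= ltime l.
Proof. by rewrite addr_ge0 // le_max lexx. Qed.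

Lemma layer_time_sum_mono l l' :
  (l <= l')%N -> \sum_(j < l) ltime j <= \sum_(j < l') ltime j.
Proof.
move=> /subnK <-; elim: (l' - l)%N => [//|k IHk].
rewrite addSn big_ord_recr /=; apply: le_trans IHk _.
by rewrite lerDl layer_time_ge0.
Qed.

Lemma layer_settled l i n :
    i \in F l ->
    raising_time s sigma delta x (est 0) + \sum_(j < l.+1) ltime j <= n%:Z ->
  est n i = x i.
Proof.
elim/ltn_ind: l i n => l IHl i n il le_n.
set n0 := raising_time s sigma delta x (est 0) + \sum_(j < l) ltime j.
have sum_ge0 : 0 <= \sum_(j < l) ltime j.
  by apply: sumr_ge0 => j _; exact: layer_time_ge0.
have n0_ge0 : 0 <= n0 by rewrite addr_ge0 ?raising_time_ge0.
pose rq := (M - set_min (F l) x) / delta.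
have q_ge0 : 0 <= Num.max 0 (Num.ceil rq) by rewrite le_max lexx.
have ge_x k j : (`|n0| <= k)%N -> x j <= est k j.
  rewrite -lez_nat gez0_abs // => le_k; apply: estimates_raised.
  by apply: le_trans le_k; rewrite lerDl.
apply: (@settling `|n0| i ge_x _ n `|Num.max 0 (Num.ceil rq)|).
- move=> k le_k; apply: spread_settled => [j|]; first exact: ge_x.
  have [isrc|/exists_constraining[k' ik' cik']] := boolP (i \in src).
    by left.
  right; exists k' => //; split=> //.
  have [l' k'l' _] := exists_layer k'.
  (* The constraining neighbor lies in an earlier layer, hence is settled from time [n0] on. *)
  have lt_l := constraining_layer ik' cik' il k'l'.
  apply: (IHl l') => //.
  move: le_k; rewrite -lez_nat gez0_abs //; apply: le_trans.
  by rewrite lerD2l layer_time_sum_mono.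
(* [x i] is at least the minimum over the layer, so the number of rises computed from that minimum
   suffices for [i]. *)
- rewrite -lerBlDl -mulr_natl -ler_pdivrMr //.
  rewrite -[_%:R]/((Posz `|_|)%:~R) gez0_abs //.
  apply: (@le_trans _ _ rq).
    by rewrite ler_pM2r ?invr_gt0 // lerB // set_min_le.
  by apply: le_trans (ceil_ge _) _; rewrite ler_int le_max lexx orbT.
(* The strict inequality required by [settling] comes from the summand 2 in [layer_time]. *)
- rewrite -ltz_nat PoszD !gez0_abs //; apply: lt_le_trans le_n.
  rewrite big_ord_recr /= addrA ltrD2l /ltime /layer_time.
  by rewrite ltrDl.
Qed.

End Spreading.

Theorem theorem2 (R : realType) (V : finType) (adj : rel V)
    (adj_sym : symmetric adj) (adj_irr : irreflexive adj)
    (adj_conn : forall i k : V, connect adj i k)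
    (e : V -> V -> R) (emin : R) (emin_gt0 : 0 < emin)
    (e_sym : forall i k, adj i k -> e i k = e k i)
    (e_ge : forall i k, adj i k -> emin <= e i k)
    (s : V -> \bar R) (s_ge0 : forall i, (0 <= s i)%E)
    (s_fin : finite_max s != set0)
    (f : R -> R -> R) (sigma : R) (sigma_gt0 : 0 < sigma)
    (f_prog : forall a b, emin <= b -> a + sigma < f a b)
    (f_mono : forall a1 a2 b, emin <= b -> a2 <= a1 -> f a2 b <= f a1 b)
    (M delta D : R) (M_ge0 : 0 <= M) (delta_gt0 : 0 < delta) (D_ge0 : 0 <= D)
    (g : R -> R) (g_ge : forall y, y + delta <= g y)
    (t0 : int) (xh : int -> V -> R)
    (xh_init : forall i, 0 <= xh t0 i)
    (xh_traj : trajectory adj e s f g M D t0 xh)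
    (x : V -> R) (x_stat : stationary adj e s f x) :
  forall (i : V) (t : int),
    t0 + raising_time s sigma delta x (xh t0)
       + \sum_(l < effective_diameter adj e s f x)
           layer_time adj e s f M delta x l < t ->
    xh t i = x i.
Proof.
move=> i t; rewrite -addrA -ltrBrDl => lt_t.
have [l il lt_l] := exists_layer adj_irr e_ge sigma_gt0 f_prog x_stat i.
have sum_mono := @layer_time_sum_mono R V adj e s f x M delta.
have sum_ge0 : 0 <= \sum_(j < l.+1) layer_time adj e s f M delta x j.
  by apply: sumr_ge0 => j _; exact: layer_time_ge0.
have le_t : raising_time s sigma delta x (xh t0)
    + \sum_(j < l.+1) layer_time adj e s f M delta x j <= t - t0.
  by apply: le_trans (ltW lt_t); rewrite lerD2l sum_mono.
have est0 : est t0 xh 0 = xh t0 by rewrite /est addr0.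
(* Since [raising_time] is nonnegative, [t] does not precede [t0] and is covered by [est]. *)
have t_ge : 0 <= t - t0.
  apply: le_trans le_t; rewrite addr_ge0 // -est0.
  exact: raising_time_ge0.
have -> : t = t0 + `|t - t0|%N by rewrite gez0_abs // subrKC.
apply: (layer_settled adj_irr e_ge sigma_gt0 f_prog f_mono x_stat delta_gt0
  D_ge0 g_ge xh_traj il).
by rewrite est0 gez0_abs.
Qed.
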